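(* Let $A$ be a non-empty set, let $h:A\to A$ be a function, and let $(B,i,v,p)$ be a co-invariant injective dilation of $h$. Then $$D=D(B,i,v,p)=\{a\in A: v(i(a))\notin i(A)\}$$ is a defect space for $h$. Moreover, $(B,i,v,p)$ is in bijective correspondence with $(B_D,i_D,v_D,p_D)$.
   Context: Let $\mathbb{Z}_+=\{0,1,2,\ldots\}$; for any self-map $f$, $f^0$ is the identity. An injective (power) dilation of $h:A\to A$ is a quadruple $(B,i,v,p)$ where $B$ is a set, $i:A\to B$ and $v:B\to B$ are injective functions, and $p:B\to B$ is an idempotent ($p\circ p=p$) with $p(B)=i(A)$, such that $i(h^n(a))=p(v^n(i(a)))$ for all $a\in A$, $n\in\mathbb{Z}_+$. It is co-invariant if $v(B\setminus i(A))\subseteq B\setminus i(A)$. Two dilations $(B,i,v,p)$ and $(B',i',v',p')$ of $h$ are in bijective correspondence (bijectively equivalent) if there is a bijection $u:B\to B'$ with $i'=ui$, $v'=uvu^{-1}$ and $p'=upu^{-1}$. A subset $D\subseteq A$ is a defect space for $h$ if $h|_{D^c}$ is injective, where $D^c=A\setminus D$ (it is not required that $h$ leaves $D^c$ invariant). For a defect space $D$ of $h$, the dilation $(B_D,i_D,v_D,p_D)$ of $h$ is defined by $B_D=(D^c\times\{0\})\cup(D\times\mathbb{Z}_+)$; $i_D(a)=(a,0)$ for $a\in A$; $v_D(a,0)=(h(a),0)$ for $a\in D^c$ and $v_D(a,m)=(a,m+1)$ for $(a,m)\in D\times\mathbb{Z}_+$; $p_D(a,m)=(h^m(a),0)$ for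 $(a,m)\in B_D$.
   Formalization: The bijective correspondence is proved assuming also that B is the union of the sets v^n(i(A)), n≥0; without this it fails (A={*}, h=id, B={0,1}, i( * )=0, v=id, p≡0), and the condition is necessary since B_D always satisfies it. *)

(* Defs.v *)
From mathcomp Require Import all_boot.
From mathcomp Require Import boolp classical_sets functions.

Set Implicit Arguments.
Unset Strict Implicit.
Unset Printing Implicit Defensive.

Local Open Scope classical_set_scope.

Section Dilations.
Variables (A : Type) (h : A -> A).

Record injective_dilation (B : Type) (i : A -> B) (v p : B -> B) : Prop := {
  dil_embed_inj : injective i;
  dil_shift_inj : injective v;
  dil_proj_idem : p \o p = p;
  dil_proj_range : range p = range i;
  dil_powers : forall (a : A) (n : nat), i (iter n h a) = p (iter n v (i a)) }.

Definition co_invariant (B : Type) (i : A -> B) (v : B -> B) : Prop :=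
  v @` (~` range i) `<=` ~` range i.

(* No point of B lies outside the v-orbits of i(A).  The defining axioms of a
   dilation say nothing about v and p outside these orbits. *)
Definition minimal (B : Type) (i : A -> B) (v : B -> B) : Prop :=
  \bigcup_n (iter n v @` range i) = [set: B].

Definition bijectively_equivalent (B : Type) (i : A -> B) (v p : B -> B)
    (B' : Type) (i' : A -> B') (v' p' : B' -> B') : Prop :=
  exists (u : B -> B') (u' : B' -> B),
    [/\ cancel u u', cancel u' u,
        i' = u \o i, v' = u \o v \o u' & p' = u \o p \o u'].

Definition defect_space (D : set A) : Prop := set_inj (~` D) h.

Definition defect_of (B : Type) (i : A -> B) (v : B -> B) : set A :=
  [set a | ~ range i (v (i a))].

Section DefectDilation.
Variable D : set A.

Definition defect_dil_set : set (A * nat) :=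
  (~` D `*` [set 0]) `|` (D `*` [set: nat]).

Definition defect_dil : Type := set_type defect_dil_set.

Lemma defect_dil_set0 (a : A) : (a, 0) \in defect_dil_set.
Proof. by rewrite in_setE; case: (EM (D a)) => Da; [right|left]. Qed.

Definition defect_embed (a : A) : defect_dil := exist _ (a, 0) (defect_dil_set0 a).

(* On defect_dil_set, x.1 outside D forces x.2 = 0, so the second branch is the
   case of a point (a, 0) with a outside D. *)
Definition defect_shift_raw (x : A * nat) : A * nat :=
  if `[< D x.1 >] then (x.1, x.2.+1) else (h x.1, 0).

Lemma defect_shift_raw_in (x : A * nat) : defect_shift_raw x \in defect_dil_set.
Proof.
rewrite /defect_shift_raw; case: asboolP => Dx; last exact: defect_dil_set0.
by rewrite in_setE; right.
Qed.

Definition defect_shift (x : defect_dil) : defect_dil :=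
  exist _ (defect_shift_raw (val x)) (defect_shift_raw_in (val x)).

Definition defect_proj (x : defect_dil) : defect_dil :=
  defect_embed (iter (val x).2 h (val x).1).

End DefectDilation.
End Dilations.

(* Main.v *)
Require Import Defs.
From mathcomp Require Import all_boot.
From mathcomp Require Import boolp classical_sets functions.

Local Open Scope classical_set_scope.

(** The power identity for n = 0 and n = 1 says that p fixes i(A) pointwise and
    that i \o h = p \o v \o i. So wherever v \o i stays inside i(A), that is
    outside the defect set D, the projection does nothing and v \o i = i \o h
    ([shift_embed_notin_defect]). There h is injective because v and i are,
    which makes D a defect space.

    The equivalence is the orbit map (a, m) |-> v^m (i a) from the defect
    dilation to B. It intertwines the embeddings, the shifts and the projections
    ([orbit_map_shift], [orbit_map_proj]). It is injective because an orbit that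
    starts in D leaves i(A) at its first step and, by co-invariance, never comes
    back ([iter_shift_notin_range]), so each point is reached at one time only.
    Its image contains i(A) and is stable under v, so it contains every v-orbit
    issued from i(A), and minimality says that these orbits fill B. *)

Section OrbitMap.
Set Implicit Arguments.
Unset Strict Implicit.
Variables (A : Type) (h : A -> A) (B : Type) (i : A -> B) (v p : B -> B).
Hypothesis dil : injective_dilation h i v p.

Local Notation D := (defect_of i v).

Lemma proj_embed (a : A) : p (i a) = i a.
Proof. by rewrite -(dil_powers dil a 0). Qed.

(** If v (i a) lies in i(A), then p fixes it, while p (v (i a)) = i (h a). *)
Lemma shift_embed_notin_defect (a : A) : ~ D a -> v (i a) = i (h a).
Proof.
move=> /contrapT[c _ ic]; rewrite (dil_powers dil a 1) /= -ic.
by rewrite proj_embed.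
Qed.

Lemma defect_space_defect_of : defect_space h D.
Proof.
move=> a b; rewrite !inE => Da Db hab.
apply: (dil_embed_inj dil); apply: (dil_shift_inj dil).
by rewrite !shift_embed_notin_defect// hab.
Qed.

Lemma iter_shift_inj (n : nat) : injective (iter n v).
Proof. by elim: n => //= n IHn x y /(dil_shift_inj dil)/IHn. Qed.

Lemma iter_shift_notin_range (coinv : co_invariant i v) (a : A) (n : nat) :
  D a -> ~ range i (iter n.+1 v (i a)).
Proof.
by move=> Da; elim: n => [//|n IHn]; apply: coinv; exists (iter n.+1 v (i a)).
Qed.

Definition orbit_map (x : defect_dil D) : B := iter (val x).2 v (i (val x).1).

Lemma defect_dil_time0 (x : defect_dil D) : ~ D (val x).1 -> (val x).2 = 0.
Proof. by move=> nDx; case: (set_mem (valP x)) => -[]. Qed.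

Lemma orbit_map_shift (x : defect_dil D) :
  orbit_map (defect_shift h x) = v (orbit_map x).
Proof.
rewrite /orbit_map /= /defect_shift_raw; case: asboolP => //= nDx.
by rewrite (defect_dil_time0 nDx) /= shift_embed_notin_defect.
Qed.

Lemma orbit_map_proj (x : defect_dil D) :
  orbit_map (defect_proj h x) = p (orbit_map x).
Proof. exact: dil_powers. Qed.

(** Cancelling the smaller power of v leaves i a = v^k (i b), where k > 0 would
    force b to be in D and so v^k (i b) to be outside i(A). *)
Lemma orbit_map_inj : co_invariant i v -> injective orbit_map.
Proof.
move=> coinv x y.
wlog le_xy : x y / (val x).2 <= (val y).2.
  move=> H xy; case/orP: (leq_total (val x).2 (val y).2) => le.
    exact: H.
  by apply/esym/H.
rewrite /orbit_map -(subnKC le_xy) iterD => /iter_shift_inj.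
case k_def: ((val y).2 - (val x).2) => [|k].
  move=> /(dil_embed_inj dil) xy1; apply: val_inj.
  rewrite [LHS]surjective_pairing [RHS]surjective_pairing xy1; congr (_, _).
  by apply/eqP; rewrite eqn_leq le_xy -subn_eq0 k_def.
have [Dy|/defect_dil_time0 y0] := EM (D (val y).1); last by rewrite y0 in k_def.
by move=> xy; case: (iter_shift_notin_range coinv (n := k) Dy); exists (val x).1.
Qed.

Lemma orbit_map_surj : minimal i v -> forall b, exists x, orbit_map x = b.
Proof.
move=> min b; have : [set: B] b by [].
rewrite -min => -[n _ [_ [a _ <-] <-]] {b}.
elim: n => [|n [x IHx]] /=; first by exists (defect_embed D a).
by exists (defect_shift h x); rewrite orbit_map_shift IHx.
Qed.

Lemma defect_dil_equivalent : co_invariant i v -> minimal i v ->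
  bijectively_equivalent i v p
    (@defect_embed A D) (@defect_shift A h D) (@defect_proj A h D).
Proof.
move=> coinv /orbit_map_surj/choice[u uK].
have Ku : cancel orbit_map u by move=> x; apply: (orbit_map_inj coinv).
exists u, orbit_map; split=> //; apply/funext => x /=.
- by rewrite -[LHS]Ku.
- by rewrite -orbit_map_shift Ku.
- by rewrite -orbit_map_proj Ku.
Qed.

End OrbitMap.

Theorem theorem1p11 (A : Type) (A_nonempty : [set: A] !=set0) (h : A -> A)
    (B : Type) (i : A -> B) (v p : B -> B)
    (dil : injective_dilation h i v p) (coinv : co_invariant i v) :
  let D := defect_of i v in
  defect_space h D /\
  (minimal i v ->
   bijectively_equivalent i v p
     (@defect_embed A D) (@defect_shift A h D) (@defect_proj A h D)).
Proof.
split; first exact: (defect_space_defect_of dil).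
exact: (defect_dil_equivalent dil coinv).
Qed.
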